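(* Let $C$ be an $(n,k)$-code and $L\ge1$. For any $d\in\{0,\dots,n-k\}$, $C$ is $\operatorname{rLD-MDS}_d(\le L)$ if and only if the dual code $C^\perp$ is $\operatorname{rMDS}_d(L+1)$.
   Context: An $(n,k)$-code is a $k$-dimensional subspace of $\mathbb F^n$; a generator matrix is a $k\times n$ matrix whose rows form a basis. For a matrix $V$ and $A\subseteq[n]$, $V|_A$ denotes the columns indexed by $A$ and $V_A$ their span. For $A_1,\dots,A_\ell\subseteq[n]$, $\mathcal G_{A_1,\dots,A_\ell}[V]$ (for $V$ with $k'$ rows) is the $\ell k'\times(k'+\sum|A_i|)$ block matrix whose $i$-th block row has $I_{k'}$ in the first block column and $V|_{A_i}$ in block column $i+1$, zeros elsewhere. A generic $m\times n$ matrix has independent indeterminates as entries. An $(n,k)$-code $C$ with generator matrix $G$ is $\operatorname{rMDS}_d(\ell)$ ($\ell\ge2$, $0\le d\le k$) if $\mathcal G_{A_1,\dots,A_\ell}[G]$ has full column rank whenever $\mathcal G_{A_1,\dots,A_\ell}[W]$ has full column rank, $W$ a generic $(k-d)\times n$ matrix. A code $C$ is $(\rho,L)$ average-radius list-decodable if for every $y\in\mathbb F^n$ and every $L+1$ distinct codewords $c_0,\dots,c_L$ we have $\frac{1}{L+1}\sum_i\operatorname{wt}(y-c_i)>\rho n$ (Hamming weight). $C$ is $\operatorname{rLD-MDS}_d(L)$ if it is $(\rho,L)$ average-radius list-decodable with $\rho=\frac{L}{L+1}\frac{n-k-d}{n}$, and $\operatorname{rLD-MDS}_d(\le L)$ if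 it is $\operatorname{rLD-MDS}_d(\ell)$ for all $\ell\in\{1,\dots,L\}$. *)

(* Defs.v *)
From HB Require Import structures.
From mathcomp Require Import all_boot all_order all_algebra.
From mathcomp Require Import mpoly.
Set Implicit Arguments. Unset Strict Implicit. Unset Printing Implicit Defensive.
Import Order.TTheory GRing.Theory Num.Theory.
Local Open Scope ring_scope.

(* Codes over a field F are represented by a (full row rank) generator matrix
   G : 'M[F]_(k, n); the code is its row space. *)

Definition restr_cols {R : Type} {m n : nat} (V : 'M[R]_(m, n)) (A : {set 'I_n})
  : 'M[R]_(m, #|A|) :=
  \matrix_(i < m, p < #|A|) V i (enum_val p).

Definition Gmat {R : pzRingType} {k' n l : nat} (A : 'I_l -> {set 'I_n})
  (V : 'M[R]_(k', n)) : 'M[R]_(\sum_(i < l) k', k' + \sum_(j < l) #|A j|) :=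
  row_mx (\mxcol_(i < l) (1%:M : 'M[R]_k'))
         (\mxblock_(i < l, j < l)
            (if i == j then restr_cols V (A j) else 0 : 'M[R]_(k', #|A j|))).

Definition generic_mx (F : fieldType) (m n : nat)
  : 'M[{fraction {mpoly F[m * n]}}]_(m, n) :=
  \matrix_(i < m, j < n) tofrac 'X_(mxvec_index i j).

Definition rMDS (F : fieldType) (k n : nat) (d l : nat) (G : 'M[F]_(k, n)) : Prop :=
  forall A : 'I_l -> {set 'I_n},
    row_full (Gmat A (generic_mx F (k - d) n)) -> row_full (Gmat A G).

Definition wt {F : fieldType} {n : nat} (x : 'rV[F]_n) : nat :=
  #|[set i : 'I_n | x 0 i != 0]|.

Definition avg_radius_LD (F : fieldType) (k n : nat) (G : 'M[F]_(k, n))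
  (rho : rat) (L : nat) : Prop :=
  forall (y : 'rV[F]_n) (c : 'I_(L.+1) -> 'rV[F]_n),
    injective c -> (forall i, (c i <= G)%MS) ->
    ((\sum_(i < L.+1) wt (y - c i))%:R / (L.+1)%:R : rat) > rho * n%:R.

Definition rLDMDS (F : fieldType) (k n : nat) (d L : nat) (G : 'M[F]_(k, n)) : Prop :=
  avg_radius_LD G ((L%:R / (L.+1)%:R) * ((n - k - d)%:R / n%:R)) L.

Definition rLDMDS_le (F : fieldType) (k n : nat) (d L : nat) (G : 'M[F]_(k, n)) : Prop :=
  forall l, (1 <= l <= L)%N -> rLDMDS d l G.

(* Main.v *)
(* Write [k' = n - k - d].  A kernel vector of [Gmat A H] is a family of vectors
   [y i] supported in [A i] with the same syndrome, i.e. [y i = y - c i] for a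
   common [y] and codewords [c i].

   If [C] is list-decodable and [Gmat A W] has full column rank, group equal
   [y i] together: the [t + 1] distinct values are supported in intersections
   [B j] of the [A i], [Gmat B W] still has full column rank, and counting rows
   gives [\sum_j #|B j| <= t * k'], against list-decodability unless [y = 0].

   Conversely take a violation of the list-decoding bound with the number of
   codewords plus the total number of errors minimal, and let [A i] be its error
   supports.  Minimality gives [\bigcap_i A i = set0] and, for proper nonempty
   [J], [(#|J| - 1) * k' + #|\bigcap_(j in J) A j| <= \sum_(j in J) #|A j|].
   Distribute the [k'] rows of a matrix among the indices, at most [k' - #|A i|]
   of them to [i], let the rows given to [i] vanish on [A i], and let the other
   entries be generic.  These inequalities are then Hall's condition for the
   columns in each [A i] to be independent, so [Gmat A W] has full column rank
   whereas [Gmat A H] does not. *)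
Require Import Defs.
From HB Require Import structures.
From mathcomp Require Import all_boot all_order all_algebra.
From mathcomp Require Import mpoly zify.
Set Implicit Arguments. Unset Strict Implicit. Unset Printing Implicit Defensive.
Import Order.TTheory GRing.Theory Num.Theory.
Local Open Scope ring_scope.

(** * Full column rank: kernel vectors, [Gmat], specialization *)

(* For nonempty [I], this says that the columns in each [A i] are independent
   and that the spans of the [V|_(A i)] meet in [0]. *)
Definition trivial_meet (K : fieldType) (k n : nat) (I : finType)
    (A : I -> {set 'I_n}) (V : 'M[K]_(k, n)) : Prop :=
  forall y : I -> 'cV[K]_n,
    (forall i e, e \notin A i -> y i e 0 = 0) ->
    (forall i j, V *m y i = V *m y j) -> forall i, y i = 0.

Lemma row_full_ker (K : fieldType) (m n : nat) (M : 'M[K]_(m, n)) :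
  row_full M <-> (forall v : 'cV[K]_n, M *m v = 0 -> v = 0).
Proof.
split=> [fM v Mv0 | inj].
  by apply: (row_full_inj fM); rewrite Mv0 mulmx0.
rewrite /row_full -mxrank_tr -/(row_free _) -kermx_eq0.
apply/eqP/row_matrixP => i; rewrite row0; apply: trmx_inj; rewrite trmx0.
apply: inj; apply: trmx_inj.
by rewrite trmx_mul trmxK trmx0 -row_mul mulmx_ker row0.
Qed.

Section RestrictedColumns.
Variables (K : fieldType) (k n : nat) (V : 'M[K]_(k, n)) (A : {set 'I_n}).

(** Multiplying by [restr_cols 1%:M A] extends a vector indexed by [A] by zero, so restricted
    columns can be handled through vectors supported in [A]. *)
Lemma restr_colsE : restr_cols V A = V *m restr_cols 1%:M A.
Proof.
apply/matrixP => i p; rewrite !mxE (bigD1 (enum_val p)) //= big1 => [|e ne].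
  by rewrite !mxE eqxx mulr1 addr0.
by rewrite !mxE (negbTE ne) mulr0.
Qed.

Lemma restr_cols1_support (u : 'cV[K]_#|A|) (e : 'I_n) :
  e \notin A -> (restr_cols 1%:M A *m u) e 0 = 0.
Proof.
move=> eA; rewrite mxE big1 // => p _; rewrite !mxE.
case: eqP => [ep|_]; last by rewrite mul0r.
by rewrite ep enum_valP in eA.
Qed.

Lemma restr_cols1_enum (u : 'cV[K]_#|A|) (p : 'I_#|A|) :
  (restr_cols 1%:M A *m u) (enum_val p) 0 = u p 0.
Proof.
rewrite mxE (bigD1 p) //= big1 => [|q nq]; rewrite !mxE.
  by rewrite eqxx mul1r addr0.
by rewrite (inj_eq enum_val_inj) eq_sym (negbTE nq) mul0r.
Qed.

Lemma restr_cols1_surj (y : 'cV[K]_n) :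
  (forall e, e \notin A -> y e 0 = 0) ->
  y = restr_cols 1%:M A *m \col_p y (enum_val p) 0.
Proof.
move=> yA; apply/matrixP => e j; rewrite ord1.
have [eA|eA] := boolP (e \in A); last by rewrite restr_cols1_support ?yA.
by rewrite -(enum_rankK_in eA eA) restr_cols1_enum mxE.
Qed.

End RestrictedColumns.

Lemma Gmat_mul_col (K : fieldType) (k n l : nat) (A : 'I_l -> {set 'I_n})
    (V : 'M[K]_(k, n)) (x : 'cV[K]_k) (u : forall i, 'cV[K]_#|A i|) :
  Gmat A V *m col_mx x (\mxcol_i u i) =
  \mxcol_i (x + V *m (restr_cols 1%:M (A i) *m u i)).
Proof.
rewrite /Gmat mul_row_col mxcol_mul mul_mxblock_mxrow -mxcolD.
apply: eq_mxcol => i; rewrite mul1mx (bigD1 i) //= eqxx big1 ?addr0.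
  by rewrite restr_colsE mulmxA.
by move=> j ji; rewrite eq_sym (negbTE ji) mul0mx.
Qed.

(** The first block of a kernel vector is minus the common value of the [V *m y i]; with [l.+1] sets
    it can be read off at [ord0]. *)
Lemma row_full_Gmat (K : fieldType) (k n l : nat) (A : 'I_l.+1 -> {set 'I_n})
    (V : 'M[K]_(k, n)) :
  row_full (Gmat A V) <-> trivial_meet A V.
Proof.
rewrite row_full_ker; split=> [inj y yA yV i | tm v].
  have /eq_mxcolP : \mxcol_i (- (V *m y ord0) +
      V *m (restr_cols 1%:M (A i) *m \col_p y i (enum_val p) 0)) = \mxcol_i 0.
    apply: eq_mxcol => j; rewrite -restr_cols1_surj; last exact: yA.
    by rewrite (yV j ord0) addNr.
  move/eq_mxcol; rewrite -Gmat_mul_col mxcol0 => /inj/eqP.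
  rewrite col_mx_eq0 => /andP[_ /eqP]; rewrite -mxcol0 => /eq_mxcolP /(_ i) yi0.
  by rewrite (restr_cols1_surj (yA i)) yi0 mulmx0.
rewrite -[v]vsubmxK -[dsubmx v]submxcolK.
set x := usubmx v; set u := submxcol _.
rewrite Gmat_mul_col -mxcol0 => /eq_mxcolP xu.
have u0 i : u i = 0.
  have yi0 : restr_cols 1%:M (A i) *m u i = 0.
    apply: (tm (fun i => restr_cols 1%:M (A i) *m u i)) => [j e|j j'].
      exact: restr_cols1_support.
    by apply: (addrI x); rewrite !xu.
  by apply/matrixP => p q; rewrite ord1 -restr_cols1_enum yi0 !mxE.
have -> : x = 0 by have := xu ord0; rewrite u0 !mulmx0 addr0.
suff -> : \mxcol_i u i = 0 by rewrite col_mx0.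
by rewrite -mxcol0; apply: eq_mxcol.
Qed.

(* A maximal minor of [M] that is nonzero after [phi] is itself nonzero. *)
Lemma row_full_specialize (R : idomainType) (K E : fieldType)
    (iota : {rmorphism R -> K}) (phi : {rmorphism R -> E}) (m n : nat)
    (M : 'M[R]_(m, n)) :
  injective iota -> row_full (map_mx phi M) -> row_full (map_mx iota M).
Proof.
move=> inj_iota fM; have := fullrowsub_unit fM.
set f := fullrankfun fM; rewrite -map_mxsub unitmxE det_map_mx unitfE => d0.
have : map_mx iota (rowsub f M) \in unitmx.
  rewrite unitmxE det_map_mx unitfE; apply: contraNneq d0 => d0.
  suff -> : \det (rowsub f M) = 0 by rewrite rmorph0.
  by apply: inj_iota; rewrite rmorph0.
rewrite map_mxsub -row_full_unit /row_full => /eqP rk.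
by rewrite eqn_leq rank_leq_col -{1}rk mxrankS // rowsub_sub.
Qed.

(** * Hall's marriage theorem *)

Section Hall.
Variables (T U : finType) (D : {set T}).
Implicit Types N : T -> {set U}.

Definition hall_condition N : bool :=
  [forall S : {set T}, (S \subset D) ==> (#|S| <= #|\bigcup_(t in S) N t|)%N].

Lemma hall_conditionP N :
  reflect (forall S : {set T}, S \subset D -> #|S| <= #|\bigcup_(t in S) N t|)%N
          (hall_condition N).
Proof. by apply: (iffP forallP) => h S; [move/implyP: (h S) | apply/implyP/h]. Qed.

Definition remove_edge N (t : T) (u : U) (s : T) : {set U} :=
  if s == t then N s :\ u else N s.

Lemma remove_edge_sub N t u s : remove_edge N t u s \subset N s.
Proof. by rewrite /remove_edge; case: eqP => // _; exact: subsetDl. Qed.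

(** Only [t] loses a neighbour, so a violating set contains [t]; [X] is the rest of it. *)
Lemma hall_violator N t u :
  hall_condition N -> ~~ hall_condition (remove_edge N t u) ->
  exists X : {set T}, [/\ t \notin X, t |: X \subset D &
    (#|(N t :\ u) :|: \bigcup_(s in X) N s| <= #|X|)%N].
Proof.
move=> /hall_conditionP hallN /forallPn[S].
rewrite negb_imply -ltnNge => /andP[SD lt].
have tS : t \in S.
  apply: contraLR lt => tS; rewrite -leqNgt.
  rewrite (eq_bigr N) ?hallN // => s sS; rewrite /remove_edge ifN //.
  by apply: contraNneq tS => <-.
exists (S :\ t); rewrite setD1K // SD !inE eqxx; split=> //.
move: lt; rewrite [#|S|](cardsD1 t) tS add1n ltnS (big_setD1 t) //=.
rewrite {1}/remove_edge eqxx; congr (#|pred_of_set (_ :|: _)| <= _)%N.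
apply: eq_bigr => s; rewrite !inE => /andP[st _].
by rewrite /remove_edge (negbTE st).
Qed.

(* Violators [X] and [Y] for the two removals would contradict Hall's condition
   on [t |: (X :|: Y)] and [X :&: Y]. *)
Lemma hall_remove_edge N t x y :
  hall_condition N -> x != y ->
  hall_condition (remove_edge N t x) || hall_condition (remove_edge N t y).
Proof.
move=> hallN xy; apply/idPn; rewrite negb_or => /andP[].
move=> /(hall_violator hallN)[X [tX XD leX]] /(hall_violator hallN)[Y [tY YD leY]].
move/hall_conditionP: hallN => hallN.
set NX := (_ :|: _) in leX; set NY := (_ :|: _) in leY.
(* As [x != y], the sets [N t :\ x] and [N t :\ y] together cover [N t]; the extra one counts
   [t]. *)
have leU : (#|X :|: Y|.+1 <= #|NX :|: NY|)%N.
  have tXY : t \notin X :|: Y by rewrite inE negb_or tX.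
  have := hallN (t |: (X :|: Y)); rewrite cardsU1 tXY setUUr subUset XD YD.
  move=> /(_ isT)/leq_trans; apply; apply/subset_leq_card.
  rewrite -setUUr big_setU1 //= bigcup_setU; apply/subsetP => u.
  rewrite !inE => /or3P[uN|->|->]; rewrite ?orbT //.
  by rewrite uN !andbT; case: eqVneq => //= ->; rewrite (negbTE xy) orbT.
have leI : (#|X :&: Y| <= #|NX :&: NY|)%N.
  have := hallN (X :&: Y) (subset_trans (subsetIl _ _) (subset_trans (subsetUr _ _) XD)).
  move/leq_trans; apply; apply/subset_leq_card/bigcupsP => s /setIP[sX sY].
  by rewrite subsetI !subsetU //; apply/orP; right; apply: (bigcup_sup s).
have := leq_add leU leI; rewrite addSn !cardsUI.
by rewrite ltnNge leq_add.
Qed.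

(** Induction on the number of edges: while some vertex has two neighbours, an edge can be removed;
    once all neighbourhoods are singletons, they are distinct. The [option] allows [U] to be
    empty. *)
Theorem hall N :
  hall_condition N ->
  exists2 f : T -> option U, {in D &, injective f} &
    {in D, forall t, exists2 u, f t = Some u & u \in N t}.
Proof.
have [m] := ubnP (\sum_(t in D) #|N t|)%N.
elim: m N => // m IHm N leNm hallN.
have [/existsP[t /andP[tD Nt2]] | small] :=
    boolP [exists t, (t \in D) && (1 < #|N t|)%N].
  have /card_gt1P[x [y [xN yN xy]]] := Nt2.
  have remove u : u \in N t -> hall_condition (remove_edge N t u) ->
      exists2 f : T -> option U, {in D &, injective f} &
        {in D, forall t, exists2 u, f t = Some u & u \in N t}.
    move=> uN /IHm [|f f_inj fN]; last first.
      exists f => // s /fN[v fs vN]; exists v => //.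
      exact: (subsetP (remove_edge_sub N t u s)).
    rewrite ltnS in leNm; apply: leq_trans leNm.
    rewrite (bigD1 t) //= [X in (_ < X)%N](bigD1 t) //= -addSn leq_add //.
      by rewrite /remove_edge eqxx [X in (_ < X)%N](cardsD1 u) uN.
    by apply: leq_sum => s _; apply/subset_leq_card/remove_edge_sub.
  by case/orP: (hall_remove_edge t hallN xy); exact: remove.
move/hall_conditionP: hallN => hallN.
have N1 t : t \in D -> exists u, N t = [set u].
  move=> tD; apply/cards1P; rewrite eqn_leq; apply/andP; split.
    by move: small => /existsPn/(_ t); rewrite tD /= -leqNgt.
  by have := hallN [set t]; rewrite sub1set big_set1 cards1; apply.
have pickN t u : N t = [set u] -> [pick v in N t] = Some u.
  move=> Ntu; case: pickP => [v|/(_ u)]; last by rewrite Ntu set11.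
  by rewrite Ntu => /set1P->.
exists (fun t => [pick v in N t]) => [s t sD tD|t /N1[u Ntu]]; last first.
  by exists u; [exact: pickN | rewrite Ntu set11].
have [[u Nsu] [v Ntv]] := (N1 s sD, N1 t tD).
rewrite (pickN _ _ Nsu) (pickN _ _ Ntv) => -[uv]; apply/eqP/idPn => st.
have := hallN [set s; t]; rewrite cards2 st subUset !sub1set sD tD => /(_ isT).
by rewrite big_setU1 ?inE //= big_set1 Nsu Ntv uv setUid cards1.
Qed.

End Hall.

(** * The generic matrix and its specializations *)

Lemma map_restr_cols (R S : Type) (f : R -> S) (m n : nat) (V : 'M[R]_(m, n))
    (A : {set 'I_n}) :
  map_mx f (restr_cols V A) = restr_cols (map_mx f V) A.
Proof. by apply/matrixP => i p; rewrite !mxE. Qed.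

Lemma map_Gmat (R S : pzRingType) (f : {rmorphism R -> S}) (k n l : nat)
    (A : 'I_l -> {set 'I_n}) (V : 'M[R]_(k, n)) :
  map_mx f (Gmat A V) = Gmat A (map_mx f V).
Proof.
rewrite /Gmat map_row_mx; congr row_mx; apply/matrixP => i j; rewrite !mxE.
  exact: rmorph_nat.
case: eqVneq => _; last by rewrite !mxE rmorph0.
by rewrite -map_restr_cols [RHS]mxE.
Qed.

Section Generic.
Variables (F : fieldType) (k n : nat).

Definition generic_poly_mx : 'M[{mpoly F[k * n]}]_(k, n) :=
  \matrix_(i, j) 'X_(mxvec_index i j).

Lemma generic_mxE :
  generic_mx F k n = map_mx (@tofrac _) generic_poly_mx.
Proof. by apply/matrixP => i j; rewrite !mxE. Qed.

Lemma map_generic_poly_mx (E : comNzRingType) (f : {rmorphism F -> E})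
    (V : 'M[E]_(k, n)) :
  map_mx (mmap f (fun t => mxvec V 0 t)) generic_poly_mx = V.
Proof. by apply/matrixP => i j; rewrite !mxE mmapX mmap1U mxvecE. Qed.

(** Substitute the entries of [V] for the indeterminates. [E] may extend [F], so [V] can itself have
    indeterminate entries. *)
Lemma trivial_meet_generic (E : fieldType) (f : {rmorphism F -> E}) (l : nat)
    (A : 'I_l.+1 -> {set 'I_n}) (V : 'M[E]_(k, n)) :
  trivial_meet A V -> trivial_meet A (generic_mx F k n).
Proof.
rewrite -!row_full_Gmat generic_mxE -map_Gmat => fV.
pose phi : {rmorphism {mpoly F[k * n]} -> E} := mmap f (fun t => mxvec V 0 t).
apply: (row_full_specialize (phi := phi)); last first.
  by rewrite map_Gmat map_generic_poly_mx.
by move=> p q /eqP; rewrite tofrac_eq => /eqP.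
Qed.

End Generic.

(* The witness matrix: row [r] vanishes on [A (g r)] and is generic elsewhere.
   Hence every row of a vector in the meet of the spans is zero, while Hall's
   condition makes the columns in each [A i] independent. *)
Lemma trivial_meet_zero_pattern (F : fieldType) (k n l : nat)
    (A : 'I_l.+1 -> {set 'I_n}) (g : 'I_k -> 'I_l.+1) :
  (forall J : {set 'I_l.+1}, J != set0 ->
     #|g @^-1: J| + #|\bigcap_(j in J) A j| <= k)%N ->
  trivial_meet A (generic_mx F k n).
Proof.
move=> leJ.
pose P : 'M[{mpoly F[k * n]}]_(k, n) :=
  \matrix_(r, e) if e \in A (g r) then 0 else 'X_(mxvec_index r e).
pose W := map_mx (@tofrac _) P.
apply: (@trivial_meet_generic _ _ _ _ (@tofrac _ \o @mpolyC _ _) _ _ W).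
move=> y yA yW i.
have Wy0 : W *m y i = 0.
  apply/matrixP => r c; rewrite ord1 (yW i (g r)) !mxE big1 // => e _.
  rewrite !mxE; case: ifP => eA; first by rewrite rmorph0 mul0r.
  by rewrite yA ?mulr0 // eA.
suff : row_full (restr_cols W (A i)).
  rewrite row_full_ker (restr_cols1_surj (yA i)) => inj.
  rewrite (inj (\col_p _)) ?mulmx0 //.
  by rewrite restr_colsE -mulmxA -restr_cols1_surj //; exact: yA.
pose N e := [set r | e \notin A (g r)].
have /hall[f f_inj fN] : hall_condition (A i) N.
  apply/hall_conditionP => S SA.
  (* Row [r] is adjacent to no column of [S] exactly when [g r] is in [J]. *)
  pose J := [set j | S \subset A j].
  have iJ : i \in J by rewrite inE.
  have J0 : J != set0 by apply/set0Pn; exists i.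
  have -> : \bigcup_(t in S) N t = ~: (g @^-1: J).
    apply/setP => r; rewrite !inE; apply/bigcupP/subsetPn.
      by case=> e eS; rewrite inE; exists e.
    by case=> e eS eA; exists e; rewrite ?inE.
  rewrite -(leq_add2l #|g @^-1: J|) cardsC card_ord.
  apply: leq_trans (leJ J J0); rewrite leq_add2l; apply/subset_leq_card.
  by apply/bigcapsP => j; rewrite inE.
(* Matched entries avoid the zero pattern, so specializing to [V] turns the columns in [A i] into
   distinct unit vectors. *)
pose V : 'M[F]_(k, n) := \matrix_(r, e) (Some r == f e)%:R.
rewrite -map_restr_cols.
pose phi : {rmorphism {mpoly F[k * n]} -> F} :=
  mmap idfun (fun t => mxvec V 0 t).
apply: (row_full_specialize (phi := phi)).
  by move=> p q /eqP; rewrite tofrac_eq => /eqP.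
apply/row_fullP; exists (restr_cols V (A i))^T.
apply/matrixP => p q; rewrite [RHS]mxE mxE.
have [r fr rN] := fN _ (enum_valP q).
have [r' fr' _] := fN _ (enum_valP p).
rewrite (bigD1 r) //= big1 => [|s sr]; rewrite !mxE.
  rewrite inE in rN; rewrite (negbTE rN) mmapX mmap1U mxvecE !mxE fr eqxx mulr1.
  rewrite addr0 -fr eq_sym (inj_in_eq f_inj) ?enum_valP //.
  by rewrite (inj_eq enum_val_inj).
case: ifP => _; first by rewrite rmorph0 mulr0.
rewrite [phi _]mmapX mmap1U mxvecE !mxE fr.
have -> : (Some s == Some r) = false by apply/eqP => -[/eqP]; rewrite (negbTE sr).
by rewrite mulr0.
Qed.

(** * Counting conditions for a trivial meet *)

Lemma big_in_setT (I : finType) (R : Type) (idx : R) (op : R -> R -> R) (f : I -> R) :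
  \big[op/idx]_(i in [set: I]) f i = \big[op/idx]_i f i.
Proof. by apply: eq_bigl => i; rewrite inE. Qed.

(** Embed ['I_k] in the disjoint union of the ['I_(delta i)] and take tags. *)
Lemma exists_bounded_fibres (I : finType) (k : nat) (delta : I -> nat) :
  (k <= \sum_i delta i)%N ->
  exists g : 'I_k -> I, forall i, (#|g @^-1: [set i]| <= delta i)%N.
Proof.
move=> le_k; pose T := {i : I & 'I_(delta i)}.
have le_kT : (k <= #|{: T}|)%N.
  apply: leq_trans le_k _; rewrite card_tagged sumnE big_map big_enum /=.
  by apply: leq_sum => i _; rewrite card_ord.
pose h (r : 'I_k) : T := enum_val (widen_ord le_kT r).
have h_inj : injective h by move=> r s /enum_val_inj[/val_inj].
exists (tag \o h) => i; rewrite -[leqRHS]card_ord -(card_imset _ h_inj).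
apply: leq_trans (leq_imset_card (Tagged (fun i => 'I_(delta i)) (i := i)) _).
apply/subset_leq_card/subsetP => u /imsetP[r]; rewrite !inE /= => /eqP hr ->.
case: (h r) hr => j x /= <-; exact: imset_f.
Qed.

Lemma card_preimset_sum (T I : finType) (g : T -> I) (J : {set I}) :
  #|g @^-1: J| = (\sum_(j in J) #|g @^-1: [set j]|)%N.
Proof.
rewrite -sum1_card (partition_big g (mem J)) => [|t]; last by rewrite inE.
apply: eq_bigr => j jJ; rewrite -sum1_card; apply: eq_bigl => t.
by rewrite !inE; case: eqP => [->|_]; rewrite ?andbF // andbT.
Qed.

Lemma trivial_meet_generic_counts (F : fieldType) (k n l : nat)
    (A : 'I_l.+1 -> {set 'I_n}) :
  (0 < l)%N -> (\sum_i #|A i| <= l * k)%N -> \bigcap_i A i = set0 ->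
  (forall J : {set 'I_l.+1}, J != set0 -> J != setT ->
     #|J| * k + #|\bigcap_(j in J) A j| <= \sum_(j in J) #|A j| + k)%N ->
  trivial_meet A (generic_mx F k n).
Proof.
move=> l_gt0 leA meetA leJ.
(* From the condition on the complement of [i]; it makes the capacities [k - #|A i|] exact
   differences. *)
have Ak i : (#|A i| <= k)%N.
  have cJ : #|~: [set i]| = l by rewrite cardsC1 card_ord.
  have J0 : ~: [set i] != set0 by rewrite -card_gt0 cJ.
  have JT : ~: [set i] != setT by apply/eqP => /setP/(_ i); rewrite !inE eqxx.
  have arith a b s : (a + s <= l * k -> l * k + b <= s + k -> a <= k)%N by lia.
  apply: arith (etrans (congr1 (fun c => c * k + _ <= _)%N (esym cJ)) (leJ _ J0 JT)).
  move: leA; rewrite (bigD1 i) //=; congr (_ + _ <= _)%N.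
  by apply: eq_bigl => j; rewrite !inE.
have sum_delta (J : {set 'I_l.+1}) :
    (\sum_(j in J) (k - #|A j|) + \sum_(j in J) #|A j| = #|J| * k)%N.
  rewrite -big_split -sum_nat_const; apply: eq_bigr => j _.
  by rewrite /= subnK.
have [|g le_g] := @exists_bounded_fibres _ k (fun i : 'I_l.+1 => k - #|A i|)%N.
  have := sum_delta setT; rewrite cardsT card_ord !big_in_setT mulSn.
  have arith a b : (a + b = k + l * k -> b <= l * k -> k <= a)%N by lia.
  by move=> /arith; apply.
apply: (trivial_meet_zero_pattern (g := g)) => J J0.
have [->|JT] := eqVneq J setT.
  by rewrite big_in_setT meetA cards0 addn0 -[leqRHS]card_ord max_card.
have leg : (#|g @^-1: J| <= \sum_(j in J) (k - #|A j|))%N.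
  by rewrite card_preimset_sum; apply: leq_sum => j _; exact: le_g.
have arith u p b s q : (p + b <= s + k -> q + s = p -> u <= q -> u + b <= k)%N.
  by lia.
exact: arith (leJ J J0 JT) (sum_delta J) leg.
Qed.

(** * Error supports of a minimal violation *)

Definition supp (F : fieldType) (n : nat) (x : 'rV[F]_n) : {set 'I_n} :=
  [set i | x 0 i != 0].

(* Changing [y] to agree with one of the [c i] on the coordinates where it
   disagrees with all of them saves one error in each of these coordinates. *)
Lemma correct_common_errors (F : fieldType) (n : nat) (I : finType)
    (J : {set I}) (y : 'rV[F]_n) (c : I -> 'rV[F]_n) :
  J != set0 -> exists y' : 'rV[F]_n,
    (\sum_(i in J) wt (y' - c i)
      + #|\bigcap_(i in J) supp (y - c i)| <= \sum_(i in J) wt (y - c i))%N.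
Proof.
case/set0Pn => i0 i0J; set B := \bigcap_(i in J) _.
have BA i : i \in J -> B \subset supp (y - c i) by move=> iJ; exact: bigcap_inf.
pose y' := \row_e if e \in B then c i0 0 e else y 0 e.
exists y'; rewrite (bigD1 i0) // [leqRHS](bigD1 i0) //= addnAC leq_add //.
  rewrite [leqRHS](_ : _ = #|supp (y - c i0)|) //.
  rewrite -(cardsID B (supp _)) (setIidPr (BA i0 i0J)) addnC leq_add2l.
  apply/subset_leq_card/subsetP => e; rewrite inE !mxE.
  by case: ifP => eB; [rewrite subrr eqxx | rewrite in_setD eB inE !mxE].
apply: leq_sum => i /andP[iJ _]; apply/subset_leq_card/subsetP => e.
rewrite inE !mxE; case: ifP => eB; last by rewrite inE !mxE.
by rewrite (subsetP (BA i iJ)).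
Qed.

(* Descent: as long as the counting conditions fail, a subfamily or a better
   centre gives a smaller violation of the list-decoding bound. *)
Lemma generic_error_supports (F : fieldType) (k n l : nat) (y : 'rV[F]_n)
    (c : 'I_l.+1 -> 'rV[F]_n) :
  (0 < l)%N -> (\sum_i wt (y - c i)%R <= l * k)%N ->
  exists l' (y' : 'rV[F]_n) (s : 'I_l'.+1 -> 'I_l.+1),
    [/\ (0 < l')%N, injective s &
        trivial_meet (fun i => supp (y' - c (s i))) (generic_mx F k n)].
Proof.
have [m] := ubnP (l + \sum_i wt (y - c i)%R)%N.
elim: m l y c => // m IHm l y c lt_m l_gt0 le_wt.
pose A i := supp (y - c i).
have [meetA|meetA] := eqVneq (\bigcap_i A i) set0; last first.
  have T0 : [set: 'I_l.+1] != set0 by apply/set0Pn; exists ord0.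
  have [y' le_y'] := correct_common_errors y c T0.
  rewrite !big_in_setT in le_y'.
  have arith a b s p : (a + b <= s -> 0 < b -> l + s < p.+1 -> l + a < p)%N.
    by lia.
  rewrite -card_gt0 in meetA.
  apply: (IHm l y' c) => //; first exact: arith le_y' meetA lt_m.
  by apply: leq_trans le_wt; apply: leq_trans le_y'; exact: leq_addr.
have [/forallP leJ|] := boolP [forall J : {set 'I_l.+1},
    (J != set0) ==> (J != setT) ==>
    (#|J| * k + #|\bigcap_(j in J) A j| <= \sum_(j in J) #|A j| + k)%N].
  exists l, y, id; split=> //; apply: trivial_meet_generic_counts => //.
  by move=> J J0 JT; move: (leJ J); rewrite J0 JT.
case/forallPn => J; rewrite !negb_imply -ltnNge => /and3P[J0 JT ltJ].
(* Recentred, the subfamily [J] has fewer than [(#|J| - 1) * k] errors: a smaller violation. *)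
have [y' le_y'] := correct_common_errors y c J0.
rewrite -[X in (_ <= X)%N]/(\sum_(i in J) #|A i|)%N in le_y'.
(* For a singleton the counting condition is an equality. *)
have J_gt1 : (1 < #|J|)%N.
  rewrite ltn_neqAle eq_sym card_gt0 J0 andbT; apply/negP => /cards1P[i Ji].
  by move: ltJ; rewrite Ji cards1 !big_set1; lia.
have ltJl : (#|J| < l.+1)%N.
  by rewrite -[X in (_ < X)%N](card_ord l.+1) -cardsT proper_card // properT.
have leJwt : (\sum_(i in J) #|A i| <= \sum_i wt (y - c i))%N.
  by rewrite [leqRHS](bigID (mem J)) /= leq_addr.
case EJ: #|J| J_gt1 ltJl ltJ => [|l'] // l'_gt0 l'_lt ltJ.
pose s (i : 'I_l'.+1) : 'I_l.+1 := enum_val (cast_ord (esym EJ) i).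
have s_inj : injective s by move=> i j /enum_val_inj/cast_ord_inj.
have sumE : (\sum_i wt (y' - c (s i)) = \sum_(i in J) wt (y' - c i))%N.
  have -> : J = s @: setT.
    apply/eqP; rewrite eq_sym eqEcard card_imset // cardsT card_ord EJ leqnn.
    by rewrite andbT; apply/subsetP => _ /imsetP[i _ ->]; exact: enum_valP.
  by rewrite big_imset ?big_in_setT //; exact: in2W.
have arith w b a t : (a + k < l'.+1 * k + b -> w + b <= a -> a <= t ->
    l + t < m.+1 -> (l' + w < m)%N /\ (w <= l' * k)%N)%N.
  by rewrite mulSn; move: (l' * k)%N; lia.
have [lt' le'] := arith _ _ _ _ ltJ le_y' leJwt lt_m.
have [|//||l2 [y2 [s2 [l2_gt0 s2_inj meet2]]]] := IHm l' y' (c \o s).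
- by rewrite /= sumE.
- by rewrite /= sumE.
by exists l2, y2, (s \o s2); split=> //; exact: inj_comp.
Qed.

(** * Repeating and intersecting the sets *)

Lemma trivial_meet_comp (K : fieldType) (k n : nat) (I I' : finType)
    (A : I -> {set 'I_n}) (V : 'M[K]_(k, n)) (h : I' -> I) :
  (forall i, exists i', h i' = i) ->
  trivial_meet A V -> trivial_meet (A \o h) V.
Proof.
move=> h_surj tm y yA yV i'.
(* The section [s] of [h] is made to pass through [i'], so that [y i'] is among the vectors shown to
   vanish. *)
have /fin_all_exists[s sP] (i : I) :
    exists j, h j = i /\ (i = h i' -> j = i').
  have [->|ne] := eqVneq i (h i'); first by exists i'.
  by have [j hj] := h_surj i; exists j; split=> // /eqP; rewrite (negbTE ne).
have [_ /(_ erefl) <-] := sP (h i').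
apply: (tm (y \o s)) => [i e eA|i j]; last exact: yV.
by apply: yA; rewrite /= (sP i).1.
Qed.

Lemma trivial_meet_fibres (K : fieldType) (k n : nat) (I J : finType)
    (A : I -> {set 'I_n}) (V : 'M[K]_(k, n)) (h : I -> J) :
  (forall j, exists i, h i = j) ->
  trivial_meet A V -> trivial_meet (fun j => \bigcap_(i | h i == j) A i) V.
Proof.
move=> h_surj tm z zB zV j; have [i <-] := h_surj j.
apply: (tm (z \o h)) => [i' e eA|i1 i2]; last exact: zV.
by apply: zB; apply: contra eA => /bigcapP; apply.
Qed.

Lemma trivial_meet_leq (K : fieldType) (k n l : nat)
    (A : 'I_l.+1 -> {set 'I_n}) (V : 'M[K]_(k, n)) :
  trivial_meet A V -> (\sum_i #|A i| <= l * k)%N.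
Proof.
move=> /row_full_Gmat/eqP rk; have := rank_leq_row (Gmat A V).
by rewrite rk sum_nat_const card_ord mulSn leq_add2l.
Qed.

(** * List decoding, duality and the two implications *)

Lemma rLDMDS_wt (F : fieldType) (k n d l : nat) (G : 'M[F]_(k, n)) :
  (0 < l)%N ->
  rLDMDS d l G <->
  forall (y : 'rV[F]_n) (c : 'I_l.+1 -> 'rV[F]_n),
    injective c -> (forall i, (c i <= G)%MS) ->
    (l * (n - k - d) < \sum_i wt (y - c i)%R)%N.
Proof.
move=> l_gt0; rewrite /rLDMDS /avg_radius_LD.
suff bound y (c : 'I_l.+1 -> 'rV[F]_n) : injective c ->
    (l%:R / l.+1%:R * ((n - k - d)%:R / n%:R) * n%:R
       < (\sum_i wt (y - c i)%R)%:R / l.+1%:R :> rat) =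
    (l * (n - k - d) < \sum_i wt (y - c i)%R)%N.
  by split=> ld y c c_inj cG; [rewrite -bound | rewrite bound] => //; exact: ld.
(* For [n = 0] the factor [n] does not cancel, but [c] cannot be injective. *)
move=> c_inj; have [n0|n_gt0] := posnP n.
  have eq_c : c ord0 = c ord_max by 
    by apply/rowP => i; move: (ltn_ord i); rewrite [X in (_ < X)%N]n0.
  by have /(congr1 val)/= l0 := c_inj _ _ eq_c; rewrite -[X in (_ < X)%N]l0 in l_gt0.
rewrite -mulrA divfK ?pnatr_eq0 -?lt0n // mulrAC ltr_pM2r ?invr_gt0 ?ltr0n //.
by rewrite -natrM ltr_nat.
Qed.

(** The code lies in the kernel of [H^T], and both have dimension [k]. *)
Lemma dual_codeword (F : fieldType) (n k : nat) (G : 'M[F]_(k, n))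
    (H : 'M[F]_(n - k, n)) (c : 'rV[F]_n) :
  row_free G -> row_free H -> G *m H^T = 0 ->
  (c <= G)%MS <-> H *m c^T = 0.
Proof.
move=> /eqP rkG /eqP rkH GH0.
have le_kn : (k <= n)%N by rewrite -rkG rank_leq_col.
have sGK : (G <= kermx H^T)%MS by rewrite sub_kermx GH0.
have /eqmxP GK : (G == kermx H^T)%MS.
  by rewrite -(geq_leqif (mxrank_leqif_eq sGK)) mxrank_ker mxrank_tr rkH rkG subKn.
rewrite GK sub_kermx; split=> [/eqP cH | Hc].
  by apply: trmx_inj; rewrite trmx_mul trmxK cH trmx0.
by apply/eqP/trmx_inj; rewrite trmx_mul trmxK Hc trmx0.
Qed.

(* Equal vectors of a kernel element are grouped together: the distinct ones
   have the same syndrome, hence differ by codewords. *)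
Lemma rMDS_of_rLDMDS (F : fieldType) (n k : nat) (G : 'M[F]_(k, n))
    (H : 'M[F]_(n - k, n)) (L d : nat) :
  row_free G -> row_free H -> G *m H^T = 0 ->
  rLDMDS_le d L G -> rMDS d L.+1 H.
Proof.
move=> fG fH GH0 ld A /row_full_Gmat tm; apply/row_full_Gmat => y yA yH.
pose U := undup (codom y).
have yU i : y i \in U by rewrite mem_undup codom_f.
have ltU i : (index (y i) U < size U)%N by rewrite index_mem.
have leU : (size U <= L.+1)%N.
  by rewrite (leq_trans (size_undup _)) // size_codom card_ord.
case EU: (size U) => [|t]; first by have := ltU ord0; rewrite EU.
pose z (j : 'I_t.+1) := nth 0 U j.
have ltU' i : (index (y i) U < t.+1)%N by rewrite -EU.
pose h i := Ordinal (ltU' i).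
have zh i : z (h i) = y i by rewrite /z nth_index.
have z_inj : injective z.
  move=> i j /eqP; rewrite nth_uniq ?undup_uniq ?EU // => /eqP ij.
  exact: val_inj.
have h_surj j : exists i, h i = j.
  have : z j \in U by rewrite mem_nth // EU.
  rewrite mem_undup => /codomP[i zj]; exists i; apply: z_inj.
  by rewrite zh.
have zH i j : H *m z i = H *m z j.
  by have [[i' <-] [j' <-]] := (h_surj i, h_surj j); rewrite !zh.
have wt_z j : (wt (z j)^T <= #|\bigcap_(i | h i == j) A i|)%N.
  apply/subset_leq_card/subsetP => e; rewrite inE mxE => ze.
  apply/bigcapP => i /eqP hi; apply: contraNT ze => eA.
  by rewrite -hi zh yA.
have le_wt : (\sum_j wt (z j)^T <= t * (n - k - d))%N.
  apply: leq_trans (trivial_meet_leq (trivial_meet_fibres h_surj tm)).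
  by apply: leq_sum => j _; exact: wt_z.
(* With a single value list decoding says nothing, but the row count already forces weight zero. *)
have [t0|t_gt0] := posnP t.
  move=> i; move: le_wt; rewrite [X in (_ <= X * _)%N]t0 mul0n leqn0 sum_nat_eq0.
  move=> /forallP/(_ (h i)); rewrite zh => /implyP/(_ isT); rewrite cards_eq0.
  move=> /eqP yi; apply/matrixP => e j; rewrite ord1 [RHS]mxE; apply/eqP/negPn.
  by move/setP/(_ e): yi; rewrite !inE mxE => ->.
have t_le : (1 <= t <= L)%N by rewrite t_gt0 -ltnS -EU.
move/(rLDMDS_wt _ _ t_gt0): (ld t t_le).
(* With this centre and these codewords the errors are exactly the [(z j)^T]. *)
move/(_ (z ord0)^T (fun j => (z ord0)^T - (z j)^T)).
have c_inj : injective (fun j => (z ord0)^T - (z j)^T).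
  by move=> i j /addrI/oppr_inj/trmx_inj/z_inj.
have cG j : ((z ord0)^T - (z j)^T <= G)%MS.
  by apply/(dual_codeword _ fG fH GH0); rewrite linearB /= !trmxK mulmxBr (zH j ord0) subrr.
move/(_ c_inj cG); rewrite ltnNge => /negP[].
by under eq_bigr do rewrite subKr.
Qed.

Lemma rLDMDS_of_rMDS (F : fieldType) (n k : nat) (G : 'M[F]_(k, n))
    (H : 'M[F]_(n - k, n)) (L d : nat) :
  row_free G -> row_free H -> G *m H^T = 0 ->
  rMDS d L.+1 H -> rLDMDS_le d L G.
Proof.
move=> fG fH GH0 mds l /andP[l_gt0 lL].
apply/rLDMDS_wt => // y c c_inj cG; rewrite ltnNge; apply/negP => le_wt.
have [l' [y' [s [l'_gt0 s_inj tm]]]] := generic_error_supports l_gt0 le_wt.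
have lt_l'L : (l'.+1 <= L.+1)%N.
  by have := leq_card s s_inj; rewrite !card_ord => /leq_trans; apply.
(* Pad to [L.+1] sets by repeating the last one. *)
pose h (i : 'I_L.+1) : 'I_l'.+1 := inord (minn i l').
have h_surj j : exists i, h i = j.
  exists (widen_ord lt_l'L j); apply: val_inj.
  by rewrite /= inordK ?ltnS ?geq_minr //; apply/minn_idPl; exact: ltn_ord j.
have := mds _ ((row_full_Gmat _ _).2 (trivial_meet_comp h_surj tm)).
move=> /row_full_Gmat/(_ (fun i => (y' - c (s (h i)))^T)) y'c.
have {}y'c j : y' - c (s j) = 0.
  have [i <-] := h_surj j; apply: trmx_inj; rewrite trmx0; apply: y'c => {i}.
    by move=> i e; rewrite /= inE negbK => /eqP <-; rewrite mxE.
  move=> i i'; apply/eqP; rewrite -subr_eq0 -mulmxBr -linearB /=; apply/eqP.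
  apply/(dual_codeword _ fG fH GH0); rewrite opprB addrC addrA subrK.
  by rewrite addmx_sub ?eqmx_opp.
have : s ord0 = s ord_max.
  by apply/c_inj/oppr_inj/(addrI y'); rewrite !y'c.
by move/s_inj/(congr1 val) => /= l'0; rewrite -l'0 in l'_gt0.
Qed.

(* G generates C (an (n,k)-code); H generates the dual code C^perp
   (H has n-k independent rows, all orthogonal to the rows of G). *)
Theorem theorem3p11 (F : fieldType) (n k : nat) (G : 'M[F]_(k, n))
  (H : 'M[F]_(n - k, n)) (L d : nat) :
  row_free G -> row_free H -> G *m H^T = 0 ->
  (1 <= L)%N -> (d <= n - k)%N ->
  (rLDMDS_le d L G <-> rMDS d L.+1 H).
Proof.
move=> fG fH GH0 _ _; split.
- exact: rMDS_of_rLDMDS fG fH GH0.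
- exact: rLDMDS_of_rMDS fG fH GH0.
Qed.
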